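(* Let $(M,g)$ be an $n$-dimensional pseudo-Riemannian manifold and $f$ a smooth function on $M$. Let $\lambda$ be a smooth function on $M$ such that $(\nabla^g,Q^{df},\mathrm{grad}_g(f),\lambda)$ is a gradient almost soliton, i.e. $\nabla^g\mathrm{grad}_g(f)+Q^{df}=\lambda I$. Then $$(n-1)^2|\mathrm{Hess}^g(f)|_g^2+\frac{(n-1)(n-2)^2}{n}|\mathrm{grad}_g(f)|_g^4-\frac{(n-1)^2}{n}(\Delta^g(f))^2+\frac{2(n-1)(n-2)}{n}|\mathrm{grad}_g(f)|_g^2\Delta^g(f)-2(n-1)(n-2)\mathrm{Hess}^g(f)(\mathrm{grad}_g(f),\mathrm{grad}_g(f))\le|\mathrm{Ric}^g|_g^2$$ and $$|\mathrm{Ric}^g|_g^2\le(n-1)^2|\mathrm{Hess}^g(f)|_g^2-\frac{(n-1)(n-2)^2}{n}|\mathrm{grad}_g(f)|_g^4+\frac1n(\mathrm{scal}^{(g,\nabla^g)})^2+\frac{2(n-2)}{n}|\mathrm{grad}_g(f)|_g^2\,\mathrm{scal}^{(g,\nabla^g)}-2(n-2)\mathrm{Ric}^g(\mathrm{grad}_g(f),\mathrm{grad}_g(f)).$$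
   Context: $\nabla^g$ is the Levi-Civita connection of $g$, $\mathrm{Ric}^g$ its Ricci tensor and $\mathrm{scal}^{(g,\nabla^g)}$ the scalar curvature of $g$. For a smooth function $f$ on $M$, $\nabla^{df}$ is the affine connection $\nabla^{df}_XY=\nabla^g_XY+df(X)Y+df(Y)X+g(X,Y)\,\mathrm{grad}_g(f)$; $\mathrm{Ric}^{df}$ is its Ricci tensor, $\mathrm{Ric}^{df}(Y,Z)=\mathrm{tr}(X\mapsto R^{\nabla^{df}}(X,Y)Z)$ with $R^{\nabla}(X,Y)=\nabla_X\nabla_Y-\nabla_Y\nabla_X-\nabla_{[X,Y]}$ (same convention for $\mathrm{Ric}^g$); and $Q^{df}$ is the $(1,1)$-tensor defined by $g(Q^{df}X,Y)=\mathrm{Ric}^{df}(X,Y)$. $\nabla^g\mathrm{grad}_g(f)$ denotes the endomorphism $X\mapsto\nabla^g_X\mathrm{grad}_g(f)$ and $I$ the identity. $\mathrm{Hess}^g(f)(X,Y)=g(\nabla^g_X\mathrm{grad}_g(f),Y)$ and $\Delta^g(f)$ is its $g$-trace. $|\cdot|_g^2$ denotes the (possibly indefinite) squared norm on $(0,2)$-tensors induced by $g$; for vectors $|\xi|_g^2=g(\xi,\xi)$ and $|\xi|_g^4=(g(\xi,\xi))^2$. *)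

(* Defs.v *)
From HB Require Import structures.
From mathcomp Require Import all_boot all_order all_algebra.
From mathcomp Require Import boolp classical_sets reals topology normedtype.
From mathcomp Require Import derive.

Set Implicit Arguments.
Unset Strict Implicit.
Unset Printing Implicit Defensive.

Import Order.TTheory GRing.Theory Num.Theory.
Import numFieldNormedType.Exports.

Local Open Scope classical_set_scope.
Local Open Scope ring_scope.

(* Vectors are row vectors: a matrix A acts as the endomorphism u |-> u *m A,
   and lin1_mx is the matrix of a linear map in this convention. *)

(* C^infinity in a neighbourhood of x: there, all iterated directional
   derivatives of F exist and are Frechet differentiable. *)
Definition infdiff (R : realType) (n : nat) (V : normedModType R)
    (F : 'rV[R]_n -> V) (x : 'rV[R]_n) : Prop :=
  \forall y \near x, forall s : seq 'rV[R]_n,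
    differentiable (foldr (fun v G => 'D_v G : 'rV[R]_n -> V) F s) y.

Record chart (R : realType) (n : nat) (M : topologicalType) := Chart {
  chart_dom : set M;
  chart_map :> M -> 'rV[R]_n;
  chart_inv : 'rV[R]_n -> M;
  chart_dom_open : open chart_dom;
  chart_img_open : open (chart_map @` chart_dom);
  chart_mapK : forall p, chart_dom p -> chart_inv (chart_map p) = p;
  chart_continuous : forall p, chart_dom p -> {for p, continuous chart_map};
  chart_inv_continuous : forall x,
    (chart_map @` chart_dom) x -> {for x, continuous chart_inv} }.

Record smooth_atlas (R : realType) (n : nat) (M : topologicalType) :=
  SmoothAtlas {
  atlas_index : Type;
  atlas_chart : atlas_index -> chart R n M;
  (* a chart of the atlas around each point *)
  index_at : M -> atlas_index;
  index_atP : forall p, chart_dom (atlas_chart (index_at p)) p;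
  atlas_compat : forall (i j : atlas_index) (p : M),
    chart_dom (atlas_chart i) p -> chart_dom (atlas_chart j) p ->
    infdiff (atlas_chart j \o chart_inv (atlas_chart i)) (atlas_chart i p) }.

Section Manifold.
Context (R : realType) (n : nat) (M : topologicalType).
Variable A : smooth_atlas R n M.

Implicit Types (p q : M) (h : M -> R) (v w : 'rV[R]_n).

Definition chart_at p : chart R n M := atlas_chart (index_at A p).

(* C^infinity in a neighbourhood of p; by atlas_compat any other chart of the
   atlas around p gives the same notion. *)
Definition smooth_at h p : Prop :=
  infdiff (h \o chart_inv (chart_at p) : _ -> R^o) (chart_at p p).

Definition smooth h : Prop := forall p, smooth_at h p.

(* The tangent space T_p M is identified with R^n through the coordinate basis
   at p of the chart chart_at p; v in T_p M acts on functions defined near p as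
   follows. Values at different points thus refer to different charts, so a
   smooth vector field need not be a continuous map M -> 'rV_n. *)
Definition tangent_act p v h : R :=
  'D_v (h \o chart_inv (chart_at p) : _ -> R^o) (chart_at p p).

Definition vfield := M -> 'rV[R]_n.

Definition field_act (X : vfield) h : M -> R := fun q => tangent_act q (X q) h.

(* X is smooth in a neighbourhood of p; taking h to be a coordinate function
   shows that the components of X are smooth near p. *)
Definition smooth_field_at (X : vfield) p : Prop :=
  forall h, smooth_at h p -> smooth_at (field_act X h) p.

(* [X, Y]_p has components X_p(Y x^i) - Y_p(X x^i), where the x^i are the
   coordinates of the chart at p. *)
Definition bracket (X Y : vfield) : vfield := fun p =>
  \row_i (tangent_act p (X p) (field_act Y (fun q => chart_at p q ord0 i))
        - tangent_act p (Y p) (field_act X (fun q => chart_at p q ord0 i))).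

(* The local field with constant components v in the chart at p: its value in
   T_q M is the image of v under the differential of the change of charts. *)
Definition const_field p v : vfield := fun q =>
  'D_v (chart_at q \o chart_inv (chart_at p)) (chart_at p q).

(* D p v Y is the covariant derivative of Y at p in the direction v, for a
   vector field Y defined and smooth near p. *)
Definition operator := M -> 'rV[R]_n -> vfield -> 'rV[R]_n.

Definition cov (D : operator) (X Y : vfield) : vfield := fun p => D p (X p) Y.

Record affine_connection (D : operator) : Prop := AffineConnection {
  conn_linear : forall p (Y : vfield), smooth_field_at Y p ->
    forall (a : R) v w, D p (a *: v + w) Y = a *: D p v Y + D p w Y;
  conn_additive : forall p (Y Z : vfield),
    smooth_field_at Y p -> smooth_field_at Z p ->
    forall v, D p v (fun q => Y q + Z q) = D p v Y + D p v Z;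
  conn_leibniz : forall p h (Y : vfield),
    smooth_at h p -> smooth_field_at Y p ->
    forall v, D p v (fun q => h q *: Y q)
              = tangent_act p v h *: Y p + h p *: D p v Y;
  conn_smooth : forall p (X Y : vfield),
    smooth_field_at X p -> smooth_field_at Y p ->
    smooth_field_at (cov D X Y) p }.

Definition curvature (D : operator) (X Y Z : vfield) : vfield := fun p =>
  cov D X (cov D Y Z) p - cov D Y (cov D X Z) p - cov D (bracket X Y) Z p.

(* R(x,y)z for tangent vectors at p; by tensoriality the choice of local
   extensions is immaterial. *)
Definition curvature_at (D : operator) p (x y z : 'rV[R]_n) : 'rV[R]_n :=
  curvature D (const_field p x) (const_field p y) (const_field p z) p.

(* Bilinear forms on T_p M are given by their matrices. *)
Definition bilin (T : 'M[R]_n) v w : R := (v *m T *m w^T) ord0 ord0.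

(* Ric(Y,Z) = tr (X |-> R(X,Y)Z) *)
Definition ricci (D : operator) p : 'M[R]_n :=
  \matrix_(i, j) \tr (lin1_mx (fun x =>
    curvature_at D p x (delta_mx ord0 i) (delta_mx ord0 j))).

Record pseudo_metric (g : M -> 'M[R]_n) : Prop := PseudoMetric {
  metric_sym : forall p, (g p)^T = g p;
  metric_nondegenerate : forall p, g p \in unitmx;
  metric_smooth : forall p (X Y : vfield),
    smooth_field_at X p -> smooth_field_at Y p ->
    smooth_at (fun q => bilin (g q) (X q) (Y q)) p }.

Record levi_civita (g : M -> 'M[R]_n) (D : operator) : Prop := LeviCivita {
  lc_connection : affine_connection D;
  lc_torsion_free : forall p (X Y : vfield),
    smooth_field_at X p -> smooth_field_at Y p ->
    cov D X Y p - cov D Y X p = bracket X Y p;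
  lc_metric : forall p (Y Z : vfield),
    smooth_field_at Y p -> smooth_field_at Z p ->
    forall v, tangent_act p v (fun q => bilin (g q) (Y q) (Z q))
              = bilin (g p) (D p v Y) (Z p) + bilin (g p) (Y p) (D p v Z) }.

(* The endomorphism E with g(E v, w) = T(v, w). *)
Definition raise (g T : 'M[R]_n) : 'M[R]_n := T *m invmx g.

Definition mxtrace_wrt (g T : 'M[R]_n) : R := \tr (raise g T).

(* |T|_g^2 = g^{ik} g^{jl} T_{ij} T_{kl}, possibly negative. *)
Definition sqnorm (g T : 'M[R]_n) : R :=
  \tr (invmx g *m T *m invmx g *m T^T).

Definition differential h p : 'rV[R]_n :=
  \row_i tangent_act p (delta_mx ord0 i) h.

(* The field with g(grad h, v) = v(h). *)
Definition grad (g : M -> 'M[R]_n) h : vfield :=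
  fun p => differential h p *m invmx (g p).

(* The endomorphism X |-> D_X grad h. *)
Definition cov_grad (g : M -> 'M[R]_n) (D : operator) h p : 'M[R]_n :=
  lin1_mx (fun v => D p v (grad g h)).

Definition hess (g : M -> 'M[R]_n) (D : operator) h p : 'M[R]_n :=
  cov_grad g D h p *m g p.

Definition laplacian (g : M -> 'M[R]_n) (D : operator) h p : R :=
  mxtrace_wrt (g p) (hess g D h p).

Definition scal (g : M -> 'M[R]_n) (D : operator) p : R :=
  mxtrace_wrt (g p) (ricci D p).

Definition connection_df (g : M -> 'M[R]_n) (D : operator) (f : M -> R)
  : operator := fun p v Y =>
  D p v Y + tangent_act p v f *: Y p + tangent_act p (Y p) f *: v
  + bilin (g p) v (Y p) *: grad g f p.

Definition Q_df (g : M -> 'M[R]_n) (D : operator) (f : M -> R) p : 'M[R]_n :=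
  raise (g p) (ricci (connection_df g D f) p).

Definition gradient_almost_soliton (g : M -> 'M[R]_n) (D : operator)
    (Q : M -> 'M[R]_n) (f lambda : M -> R) : Prop :=
  forall p, cov_grad g D f p + Q p = (lambda p)%:M.

End Manifold.

(* Main.v *)
(* Subtracting the curvatures of nabla^df and nabla^g and tracing gives
     Ric^df = Ric - n Hess f + (Lap f + n |grad f|^2) g + (n-2) df (x) df,
   so the soliton equation reads
     Ric = (n-1) Hess f - (n-2) df (x) df + mu g
   for some function mu.  For every (0,2)-tensor B and scalar c,
     |B + c g|^2 - |B|^2 + (tr B)^2 / n = n (c + (tr B) / n)^2 >= 0,
   in any signature since |g|^2 = n.  The first inequality is the case
   B = (n-1) Hess f - (n-2) df (x) df, c = mu, the second one the case
   B = Ric + (n-2) df (x) df, c = -mu. *)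

Require Import Defs.
From HB Require Import structures.
From mathcomp Require Import all_boot all_order all_algebra.
From mathcomp Require Import boolp classical_sets reals topology normedtype.
From mathcomp Require Import derive.
From mathcomp Require Import landau interval ring lra.
From mathcomp Require Import functions.

Set Implicit Arguments.
Unset Strict Implicit.
Unset Printing Implicit Defensive.

Import Order.TTheory GRing.Theory Num.Theory.
Import numFieldNormedType.Exports.

Local Open Scope ring_scope.

(** * Smooth functions of several variables *)

(** Vectors at different points are written in different charts, so neither the components of a
    field nor the entries of [g] can be differentiated directly. All calculus goes through
    functions: near [p] a coordinate field of the chart at [p] acts as a directional derivative
    there. Symmetry of second derivatives then gives commuting coordinate fields and, by absence of
    torsion, a symmetric Hessian. The gradient must be shown to be smooth before the Leibniz rule
    applies to the term [g(Y,Z) grad f] of the deformed connection. The constant [(n-1)(n-2)^2/n] in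
    both bounds is [(n-2)^2 - (n-2)^2/n]: the tensor df (x) df has squared norm [|grad f|^4] and
    trace [|grad f|^2]. *)

Section IteratedDerivatives.
Local Open Scope classical_set_scope.
Context (R : realType) (n : nat).
Local Notation E := 'rV[R]_n.

Lemma near_eq_differentiable (V W : normedModType R) (F G : V -> W) (x : V) :
  (\forall y \near x, F y = G y) -> differentiable F x -> differentiable G x.
Proof.
move=> FG /diff_locallyP[cF dF]; apply/diff_locallyP.
(* [G] inherits the first-order expansion of [F]; uniqueness then identifies its differential with
   that of [F]. *)
have dG : G \o shift x = cst (G x) + 'd F x +o_ 0 id.
  apply/eqaddoP => e e0; move/eqaddoP: dF => /(_ e e0).
  have : \forall y \near (0 : V), F (y + x) = G (y + x).
    by move: FG; rewrite (near_shift 0 x) /=; apply: filterS => y; rewrite /= subr0.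
  have FxGx := nbhs_singleton FG.
  by apply: filterS2 => y; rewrite /= -!fctE /= !fctE FxGx => ->.
by rewrite (diff_unique cF dG).
Qed.

Lemma near_open (T : topologicalType) (P : T -> Prop) (x : T) :
  (\forall y \near x, P y) ->
  exists U, [/\ open U, U x & forall y, U y -> P y].
Proof.
by rewrite -nbhs_nearE nbhsE => -[U [oU Ux] UP]; exists U.
Qed.

Lemma derive_comp (U V W : normedModType R) (F : U -> V) (G : V -> W) x v :
  differentiable F x -> differentiable G (F x) ->
  'D_v (G \o F) x = 'D_('D_v F x) G (F x).
Proof.
move=> dF dG; rewrite deriveE; last exact: differentiable_comp.
by rewrite diff_comp//= deriveE// deriveE.
Qed.

(** Grading by order allows induction: the derivative of a product is a sum of products, which
    iterating along one list of directions does not express. A fixed open set replaces a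
    neighbourhood filter, so that functions equal on it have equal derivatives on it. *)
Fixpoint ndiff (k : nat) (U : set E) (F : E -> R^o) : Prop :=
  (forall y, U y -> differentiable F y) /\
  (if k is k'.+1 then forall v, ndiff k' U ('D_v F) else True).

Lemma ndiff_differentiable k U F y : ndiff k U F -> U y -> differentiable F y.
Proof. by case: k => [|k] [dF _]; exact: dF. Qed.

Lemma ndiffP (U : set E) (F : E -> R^o) :
  (forall s y, U y ->
     differentiable (foldr (fun v G => 'D_v G : E -> R^o) F s) y) <->
  (forall k, ndiff k U F).
Proof.
split=> [dF k|dF s].
  elim: k F dF => [|k IH] F dF; first by split => // y Uy; exact: (dF [::]).
  split=> [y Uy|v]; first exact: (dF [::]).
  (* [foldr] applies the head of the list last, so the innermost derivative, which [ndiff] peels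
     off, stands at the end. *)
  by apply: IH => s y Uy; have := dF (rcons s v) y Uy; rewrite foldr_rcons.
elim/last_ind: s F dF => [|s v IH] F dF y Uy.
  exact: ndiff_differentiable (dF 0%N) Uy.
by rewrite foldr_rcons; apply: IH => // k; have [_] := dF k.+1; exact.
Qed.

Lemma infdiffP (F : E -> R^o) x :
  infdiff F x <-> exists U, [/\ open U, U x & forall k, ndiff k U F].
Proof.
split=> [|[U [oU Ux /ndiffP dF]]].
  move=> /near_open[U [oU Ux UF]].
  by exists U; split => //; apply/ndiffP => s y Uy; exact: UF.
rewrite /infdiff; have : nbhs x U by exact: open_nbhs_nbhs.
by apply: filterS => y Uy s; exact: dF.
Qed.

Lemma ndiff_le k U F : ndiff k.+1 U F -> ndiff k U F.
Proof.
elim: k F => [|k IH] F [dF DF]; split => // v.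
exact/IH/DF.
Qed.

Lemma ndiff_subset k (U V : set E) F : V `<=` U -> ndiff k U F -> ndiff k V F.
Proof.
move=> VU; elim: k F => [|k IH] F [dF DF]; split => //.
- by move=> y /VU; exact: dF.
- by move=> y /VU; exact: dF.
- by move=> v; exact/IH/DF.
Qed.

Lemma ndiff_eq k (U : set E) F G : open U -> (forall y, U y -> F y = G y) ->
  ndiff k U F -> ndiff k U G.
Proof.
move=> oU; elim: k F G => [|k IH] F G FG [dF DF].
- split=> // y Uy; apply: near_eq_differentiable (dF _ Uy).
  by have : nbhs y U by [exact: open_nbhs_nbhs]; exact: filterS.
- split=> [y Uy|v].
    apply: near_eq_differentiable (dF _ Uy).
    by have : nbhs y U by [exact: open_nbhs_nbhs]; exact: filterS.
  apply: IH (DF v) => y Uy; apply: near_eq_derive.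
  by have : nbhs y U by [exact: open_nbhs_nbhs]; exact: filterS.
Qed.

Lemma ndiff_cst k U (c : R) : ndiff k U (fun=> c).
Proof.
elim: k c => [|k IH] c; split=> [y _|] //; try exact: differentiable_cst.
move=> v; rewrite (_ : 'D_v _ = fun=> 0); first exact: IH.
by apply/funext => y; exact: derive_cst.
Qed.

Lemma derive_coord (v y : E) i :
  'D_v (fun y : E => y ord0 i : R^o) y = v ord0 i.
Proof.
apply: cvg_lim => //.
apply: (cvg_near_cst (v ord0 i)).
near=> h; rewrite /= !mxE addrK /GRing.scale/= mulKf//.
by near: h; exact: nbhs_dnbhs_neq.
Unshelve. all: by end_near. Qed.

Lemma ndiff_coord k U i : ndiff k U (fun y : E => y ord0 i).
Proof.
have dC (y : E) : differentiable (fun y : E => y ord0 i : R^o) y.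
  exact: differentiable_coord.
case: k => [|k]; split=> // v.
rewrite (_ : 'D_v _ = fun=> v ord0 i); first exact: ndiff_cst.
by apply/funext => y; exact: derive_coord.
Qed.

Lemma ndiffD k (U : set E) F G : open U ->
  ndiff k U F -> ndiff k U G -> ndiff k U (fun y => F y + G y).
Proof.
move=> oU; elim: k F G => [|k IH] F G [dF DF] [dG DG].
  by split=> // y Uy; apply: differentiableD; [exact: dF|exact: dG].
split=> [y Uy|v]; first by apply: differentiableD; [exact: dF|exact: dG].
apply: ndiff_eq (IH _ _ (DF v) (DG v)) => // y Uy.
by rewrite [RHS]deriveD//; apply: diff_derivable; [exact: dF|exact: dG].
Qed.

Lemma ndiffM k (U : set E) F G : open U ->
  ndiff k U F -> ndiff k U G -> ndiff k U (fun y => F y * G y : R^o).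
Proof.
move=> oU; elim: k F G => [|k IH] F G nF nG.
  case: nF nG => [dF _] [dG _].
  by split=> // y Uy; apply: differentiableM; [exact: dF|exact: dG].
have [dF DF] := nF; have [dG DG] := nG.
split=> [y Uy|v]; first by apply: differentiableM; [exact: dF|exact: dG].
have := ndiffD oU (IH _ _ (ndiff_le nF) (DG v)) (IH _ _ (ndiff_le nG) (DF v)).
apply: ndiff_eq => // y Uy.
by rewrite [RHS]deriveM//; apply: diff_derivable; [exact: dF|exact: dG].
Qed.

Lemma ndiffV k (U : set E) F : open U -> (forall y, U y -> F y != 0) ->
  ndiff k U F -> ndiff k U (fun y => (F y)^-1 : R^o).
Proof.
move=> oU F0; elim: k => [[dF _]|k IH nF].
  by split=> // y Uy; apply: differentiableV; [exact: dF|exact: F0].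
have [dF DF] := nF.
split=> [y Uy|v]; first by apply: differentiableV; [exact: dF|exact: F0].
(* Order [k] for [1/F] is enough, since its derivative is [- F^-2 'D_v F]. *)
have nV := IH (ndiff_le nF).
have := ndiffM oU (ndiffM oU (ndiff_cst k U (-1)) (ndiffM oU nV nV)) (DF v).
apply: ndiff_eq => // y Uy.
rewrite [RHS]deriveV//; [|exact: F0|by apply: diff_derivable; exact: dF].
by rewrite /GRing.scale/= mulN1r -expr2 exprVn.
Qed.

Lemma infdiff_eq (F G : E -> R^o) x :
  (\forall y \near x, F y = G y) -> infdiff F x -> infdiff G x.
Proof.
move=> /near_open[V [oV Vx VFG]] /infdiffP[U [oU Ux nF]]; apply/infdiffP.
exists (U `&` V); split=> //; first exact: openI.
move=> k; apply: (@ndiff_eq _ _ F); [exact: openI|by move=> y [_ /VFG]|].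
by apply: ndiff_subset (nF k) => y [].
Qed.

Lemma infdiff_cst (c : R) x : infdiff (fun=> c : R^o) (x : E).
Proof.
by apply/infdiffP; exists setT; split=> // [|k]; [exact: openT|exact: ndiff_cst].
Qed.

Lemma infdiff_coord i x : infdiff (fun y : E => y ord0 i : R^o) x.
Proof.
by apply/infdiffP; exists setT; split=> // [|k]; [exact: openT|exact: ndiff_coord].
Qed.

Lemma infdiffD (F G : E -> R^o) x :
  infdiff F x -> infdiff G x -> infdiff (fun y => F y + G y : R^o) x.
Proof.
move=> /infdiffP[U [oU Ux nF]] /infdiffP[V [oV Vx nG]]; apply/infdiffP.
have oUV := openI oU oV.
exists (U `&` V); split=> // k; apply: ndiffD => //.
  by apply: ndiff_subset (nF k) => y [].
by apply: ndiff_subset (nG k) => y [].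
Qed.

Lemma infdiffM (F G : E -> R^o) x :
  infdiff F x -> infdiff G x -> infdiff (fun y => F y * G y : R^o) x.
Proof.
move=> /infdiffP[U [oU Ux nF]] /infdiffP[V [oV Vx nG]]; apply/infdiffP.
have oUV := openI oU oV.
exists (U `&` V); split=> // k; apply: ndiffM => //.
  by apply: ndiff_subset (nF k) => y [].
by apply: ndiff_subset (nG k) => y [].
Qed.

Lemma infdiffV (F : E -> R^o) x :
  F x != 0 -> infdiff F x -> infdiff (fun y => (F y)^-1 : R^o) x.
Proof.
move=> Fx /infdiffP[U [oU Ux nF]]; apply/infdiffP.
have : \forall y \near x, F y != 0.
  have /differentiable_continuous cF := ndiff_differentiable (nF 0%N) Ux.
  exact: (@cvgr_neq0 R R^o _ (nbhs x) _ F (F x) cF Fx).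
move=> /near_open[V [oV Vx VF]].
have oUV := openI oU oV.
exists (U `&` V); split=> // k; apply: ndiffV => //; first by move=> y [_ /VF].
by apply: ndiff_subset (nF k) => y [].
Qed.

Lemma infdiff_near_differentiable (F : E -> R^o) x :
  infdiff F x -> \forall y \near x, differentiable F y.
Proof. by apply: filterS => y /(_ [::]). Qed.

Lemma infdiff_derive (F : E -> R^o) v x : infdiff F x -> infdiff ('D_v F : E -> R^o) x.
Proof.
by apply: filterS => y dF s; have := dF (rcons s v); rewrite foldr_rcons.
Qed.

End IteratedDerivatives.

(** * Symmetry of second derivatives *)

Section Schwarz.
Local Open Scope classical_set_scope.
Context (R : realType) (V : normedModType R).
Implicit Types (F : V -> R^o) (a x v w : V).

Lemma is_derive_line F a v (t : R) : differentiable F (t *: v + a) ->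
  is_derive t 1 (fun t : R => F (t *: v + a) : R) ('D_v F (t *: v + a)).
Proof.
move=> /(@diff_derivable _ _ _ _ _ v).
have E : (fun h : R => h^-1 *: ((F \o shift (t *: v + a)) (h *: v)
           - F (t *: v + a))) =
         (fun h : R => h^-1 *: (((fun t : R => F (t *: v + a) : R) \o shift t)
           (h *: (1 : R)) - F (t *: v + a))).
  by apply/funext => h /=; rewrite [h%:A]mulr1 scalerDl addrA.
move=> dF; apply: DeriveDef.
  by move: dF; rewrite /derivable E.
by rewrite /derive E.
Qed.

(* Mean value theorem in the direction [v], then differentiability of ['D_v F]
   at [x]. *)
Lemma second_difference F x v w :
  (\forall y \near x, differentiable F y) -> differentiable ('D_v F) x ->
  forall e : R, 0 < e -> \forall h \near (0 : R)^'+,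
    `|F (h *: v + (h *: w + x)) - F (h *: w + x) - F (h *: v + x) + F x
      - h ^+ 2 * 'D_w ('D_v F) x| <= e * h ^+ 2.
Proof.
move=> dF dG e e0; set G := 'D_v F.
(* All increments below have norm at most [h * c], so two remainders with factor [e / (2 * c)] add
   up to at most [e * h]. The summand 1 keeps [c] positive when [v] and [w] vanish. *)
pose c := `|v| + `|w| + 1.
have c0 : 0 < c by rewrite ltr_wpDl// addr_ge0.
have e'0 : 0 < e / (2 * c) by rewrite divr_gt0// mulr_gt0.
have /eqaddoP/(_ _ e'0) rG := diff_locally dG.
have dF0 : \forall k \near (0 : V), differentiable F (k + x).
  by move: dF; rewrite (near_shift 0 x) /=; apply: filterS => y; rewrite /= subr0.
have : \forall k \near (0 : V),
  `|G (k + x) - (G x + 'd G x k)| <= e / (2 * c) * `|k| /\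
  differentiable F (k + x) by exact: filterI rG dF0.
rewrite -nbhs_nearE => /nbhs_ballP[d /= d0 dB].
have B (k : V) : `|k| < d -> 
  `|G (k + x) - (G x + 'd G x k)| <= e / (2 * c) * `|k| /\
  differentiable F (k + x).
  by move=> kd; apply: (dB k); rewrite -ball_normE /= sub0r normrN.
near=> h.
have h0 : 0 < h by near: h; exact: nbhs_right_gt.
have hd : h * c < d.
  rewrite -ltr_pdivlMr//; near: h; apply: nbhs_right_lt; exact: divr_gt0.
(* The boolean selects one of the two segments in direction [v], starting at [h *: w + x] or at
   [x]. *)
have small t (b : bool) : 0 <= t <= h -> `|t *: v + b%:R *: (h *: w)| <= h * c.
  move=> /andP[t0 th]; apply: (le_trans (ler_normD _ _)).
  rewrite !normrZ ger0_norm// (ger0_norm (ltW h0)) /c.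
  have Hv : t * `|v| <= h * `|v| by rewrite ler_wpM2r.
  have Hw : `|b%:R : R| * (h * `|w|) <= h * `|w|.
    by case: b; rewrite ?normr1 ?mul1r// normr0 mul0r mulr_ge0// ltW.
  by lra.
pose phi (t : R) : R := F (t *: v + (h *: w + x)) - F (t *: v + x).
have dline t (b : bool) : 0 <= t <= h ->
    differentiable F (t *: v + (b%:R *: (h *: w) + x)).
  move=> th; rewrite addrA; apply: (B _ _).2.
  exact: le_lt_trans (small _ _ th) hd.
have dphi t : 0 <= t <= h ->
    is_derive t 1 phi (G (t *: v + (h *: w + x)) - G (t *: v + x)).
  move=> th; apply: is_deriveB; apply: is_derive_line.
    by have := dline t true th; rewrite scale1r.
  by have := dline t false th; rewrite scale0r add0r.
have [||t th] := @MVT R phi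
  (fun t => G (t *: v + (h *: w + x)) - G (t *: v + x)) 0 h h0.
- by move=> t; rewrite in_itv /= => /andP[t0 th]; apply: dphi; rewrite !ltW.
- apply: derivable_within_continuous => t; rewrite in_itv /= => th.
  by have [] := dphi t th.
rewrite /phi !scale0r !add0r subr0 => Hphi.
move: th; rewrite in_itv /= => /andP[/ltW t0 /ltW th].
have {}th : 0 <= t <= h by rewrite t0 th.
have H1 := small t true th; have H2 := small t false th.
have [r1 _] := B _ (le_lt_trans H1 hd); have [r2 _] := B _ (le_lt_trans H2 hd).
move: H1 H2 r1 r2; rewrite scale1r scale0r addr0 -addrA => H1 H2 r1 r2.
rewrite (_ : _ + F x = F (h *: v + (h *: w + x)) - F (h *: v + x)
                       - (F (h *: w + x) - F x)); last by ring.
rewrite Hphi deriveE//.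
have lind : 'd G x (t *: v + h *: w) = 'd G x (t *: v) + h * 'd G x w.
  by rewrite linearD; congr (_ + _); rewrite linearZ.
rewrite lind in r1.
have e2 : e / (2 * c) * (h * c) = e * h / 2.
  by field; rewrite gt_eqF.
have r1' := le_trans r1 (ler_wpM2l (ltW e'0) H1).
have r2' := le_trans r2 (ler_wpM2l (ltW e'0) H2).
rewrite e2 in r1' r2'.
(* The contributions of ['d G x (t *: v)] cancel, so the unknown [t] of the mean value theorem
   survives only in the two remainders. *)
rewrite (_ : _ - _ = h * ((G (t *: v + (h *: w + x))
   - (G x + ('d G x (t *: v) + h * 'd G x w)))
   - (G (t *: v + x) - (G x + 'd G x (t *: v))))); last by ring.
rewrite normrM (ger0_norm (ltW h0)).
have := ler_wpM2l (ltW h0) (le_trans (ler_normB _ _) (lerD r1' r2')).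
by move=> /le_trans; apply; lra.
Unshelve. all: by end_near. Qed.

(** The second difference is symmetric in [v] and [w], so for small [h] it lies within
    [e / 2 * h ^+ 2] of [h ^+ 2] times either mixed derivative. *)
Lemma derive_comm F x v w : (\forall y \near x, differentiable F y) ->
  differentiable ('D_v F) x -> differentiable ('D_w F) x ->
  'D_v ('D_w F) x = 'D_w ('D_v F) x.
Proof.
move=> dF dv dw; apply/eqP; rewrite -subr_eq0 -normr_le0.
apply/ler_addgt0Pr => e e0; rewrite add0r.
have e20 : 0 < e / 2 by rewrite divr_gt0.
have Sv := second_difference w dF dv e20.
have Sw := second_difference v dF dw e20.
have [h [h0 [Hv Hw]]] := filter_ex (filterI (nbhs_right_gt (0 : R)) (filterI Sv Sw)).
have h20 : 0 < h ^+ 2 by rewrite exprn_gt0.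
rewrite [h *: w + (h *: v + x)]addrCA in Hw.
rewrite -(ler_pM2r h20) -{1}(gtr0_norm h20) -normrM.
move: Hv Hw; move: (F _) (F _) (F _) (F _) ('D_w _ x) ('D_v _ x).
move=> d c b a Dw Dv Hv Hw.
rewrite (_ : (Dv - Dw) * h ^+ 2 = (a - b - c + d - h ^+ 2 * Dw)
  - (a - c - b + d - h ^+ 2 * Dv)); last by ring.
by apply: (le_trans (le_trans (ler_normB _ _) (lerD Hv Hw))); lra.
Qed.

End Schwarz.

(** * Smooth functions and vector fields in charts *)

Section LocalCalculus.
Local Open Scope classical_set_scope.
Context (R : realType) (n : nat) (M : topologicalType) (A : smooth_atlas R n M).
Implicit Types (p q : M) (h k : M -> R) (v w : 'rV[R]_n) (X Y Z : vfield R n M).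

Lemma chart_at_dom p : chart_dom (chart_at A p) p.
Proof. exact: index_atP. Qed.

Lemma chart_near (c : chart R n M) p : chart_dom c p ->
  \forall y \near c p, chart_dom c (chart_inv c y) /\ c (chart_inv c y) = y.
Proof.
move=> cp.
have : nbhs (c p) (c @` chart_dom c).
  by apply: open_nbhs_nbhs; split; [exact: chart_img_open|exists p].
by apply: filterS => _ [q cq <-]; rewrite chart_mapK.
Qed.

Lemma chart_inv_near (c : chart R n M) p (P : M -> Prop) : chart_dom c p ->
  (\forall q \near p, P q) -> \forall y \near c p, P (chart_inv c y).
Proof.
move=> cp pP; apply: (@chart_inv_continuous _ _ _ c (c p) _ P); first by exists p.
by rewrite chart_mapK.
Qed.

Lemma change_chart_near (c d : chart R n M) q (T : Type) (h : M -> T) :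
  chart_dom c q -> chart_dom d q ->
  \forall y \near c q, h (chart_inv c y) =
    ((h \o chart_inv d) \o (d \o chart_inv c)) y.
Proof.
move=> cq dq.
have : \forall y \near c q, chart_dom d (chart_inv c y).
  apply: chart_inv_near => //.
  by apply: open_nbhs_nbhs; split => //; exact: chart_dom_open.
by apply: filterS => y dy /=; rewrite chart_mapK.
Qed.

Lemma transition_differentiable p p' q :
  chart_dom (chart_at A p) q -> chart_dom (chart_at A p') q ->
  differentiable (chart_at A p' \o chart_inv (chart_at A p)) (chart_at A p q).
Proof.
by move=> pq p'q; exact: (nbhs_singleton (atlas_compat pq p'q) [::]).
Qed.

Lemma differentiable_change_chart p p' q h :
  chart_dom (chart_at A p) q -> chart_dom (chart_at A p') q ->
  differentiable (h \o chart_inv (chart_at A p) : _ -> R^o) (chart_at A p q) ->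
  differentiable (h \o chart_inv (chart_at A p') : _ -> R^o) (chart_at A p' q).
Proof.
move=> pq p'q dh.
pose t := chart_at A p \o chart_inv (chart_at A p').
apply: (@near_eq_differentiable _ _ _
  ((h \o chart_inv (chart_at A p) : _ -> R^o) \o t)).
  by apply: filterS (change_chart_near h p'q pq) => y /esym.
apply: differentiable_comp; first exact: transition_differentiable.
by rewrite /t /= chart_mapK.
Qed.

(** This is the chain rule: [const_field] is the derivative of the transition map to the chart at
    [q], and [tangent_act] differentiates [h] in that chart. *)
Lemma const_field_actE p q v h : chart_dom (chart_at A p) q ->
  differentiable (h \o chart_inv (chart_at A p) : _ -> R^o) (chart_at A p q) ->
  field_act A (const_field A p v) h q =
  'D_v (h \o chart_inv (chart_at A p) : _ -> R^o) (chart_at A p q).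
Proof.
move=> pq dh; rewrite /field_act /tangent_act /const_field.
have qq := chart_at_dom q.
have dhq := differentiable_change_chart pq qq dh.
have dt := transition_differentiable pq qq.
set t := chart_at A q \o chart_inv (chart_at A p) in dt *.
have e0 : t (chart_at A p q) = chart_at A q q by rewrite /t /= chart_mapK.
rewrite [RHS](near_eq_derive _ (change_chart_near h pq qq)).
rewrite -e0 in dhq *.
exact: esym (derive_comp v dt dhq).
Qed.

(** Smoothness at [p] is read in the chart at [p], whereas [tangent_act] at a nearby [q] uses the
    chart at [q]; differentiability is therefore recorded in both. *)
Lemma smooth_at_near_diff p h : smooth_at A h p ->
  \forall y \near chart_at A p p, let q := chart_inv (chart_at A p) y in
   [/\ chart_dom (chart_at A p) q, chart_at A p q = y,
    differentiable (h \o chart_inv (chart_at A p) : _ -> R^o) y &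
    differentiable (h \o chart_inv (chart_at A q) : _ -> R^o) (chart_at A q q)].
Proof.
move=> /infdiff_near_differentiable sh.
have := chart_near (chart_at_dom p); apply: filterS2 sh => y dh [pq yq] /=.
split=> //; apply: (differentiable_change_chart pq (chart_at_dom _)).
by rewrite yq.
Qed.

Lemma const_field_act_near p v h : smooth_at A h p ->
  \forall y \near chart_at A p p,
    field_act A (const_field A p v) h (chart_inv (chart_at A p) y) =
    'D_v (h \o chart_inv (chart_at A p) : _ -> R^o) y.
Proof.
move=> /smooth_at_near_diff; apply: filterS => y [pq yq dh _].
by rewrite const_field_actE ?yq.
Qed.

Lemma const_field_smooth p v : smooth_field_at A (const_field A p v) p.
Proof.
move=> h sh; apply: infdiff_eq (infdiff_derive v sh).
by apply: filterS (const_field_act_near v sh) => y /esym.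
Qed.

Lemma const_field_id p v : const_field A p v p = v.
Proof.
rewrite /const_field -[RHS](derive_id (chart_at A p p)).
apply: near_eq_derive; apply: filterS (chart_near (chart_at_dom p)) => y [].
by [].
Qed.

Lemma smooth_at_near p h k :
  (\forall y \near chart_at A p p, h (chart_inv (chart_at A p) y) =
                                 k (chart_inv (chart_at A p) y)) ->
  smooth_at A h p -> smooth_at A k p.
Proof. by move=> hk; exact: infdiff_eq. Qed.

Lemma smooth_at_cst p (c : R) : smooth_at A (fun=> c) p.
Proof. exact: infdiff_cst. Qed.

Lemma smooth_atD p h k : smooth_at A h p -> smooth_at A k p ->
  smooth_at A (fun q => h q + k q) p.
Proof. exact: infdiffD. Qed.

Lemma smooth_atM p h k : smooth_at A h p -> smooth_at A k p ->
  smooth_at A (fun q => h q * k q) p.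
Proof. exact: infdiffM. Qed.

Lemma smooth_atV p h : h p != 0 -> smooth_at A h p ->
  smooth_at A (fun q => (h q)^-1) p.
Proof.
by move=> hp; apply: infdiffV; rewrite /= chart_mapK//; exact: chart_at_dom.
Qed.

Lemma smooth_at_sum p (I : Type) (r : seq I) (P : pred I) (F : I -> M -> R) :
  (forall i, P i -> smooth_at A (F i) p) ->
  smooth_at A (fun q => \sum_(i <- r | P i) F i q) p.
Proof.
move=> sF; elim: r => [|i r IH].
  rewrite (_ : (fun q => _) = fun=> 0); first exact: smooth_at_cst.
  by apply/funext => q; rewrite big_nil.
have [Pi|NPi] := boolP (P i).
  rewrite (_ : (fun q => _) = fun q => F i q + \sum_(i <- r | P i) F i q).
    by apply: smooth_atD => //; exact: sF.
  by apply/funext => q; rewrite big_cons Pi.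
rewrite (_ : (fun q => _) = fun q => \sum_(i <- r | P i) F i q) //.
by apply/funext => q; rewrite big_cons (negbTE NPi).
Qed.

Lemma smooth_at_prod p (I : Type) (r : seq I) (F : I -> M -> R) :
  (forall i, smooth_at A (F i) p) ->
  smooth_at A (fun q => \prod_(i <- r) F i q) p.
Proof.
move=> sF; elim: r => [|i r IH].
  rewrite (_ : (fun q => _) = fun=> 1); first exact: smooth_at_cst.
  by apply/funext => q; rewrite big_nil.
rewrite (_ : (fun q => _) = fun q => F i q * \prod_(i <- r) F i q).
  exact: smooth_atM.
by apply/funext => q; rewrite big_cons.
Qed.

Lemma smooth_at_det p m (B : M -> 'M[R]_m) :
  (forall i j, smooth_at A (fun q => B q i j) p) ->
  smooth_at A (fun q => \det (B q)) p.
Proof.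
move=> sB; rewrite /determinant; apply: smooth_at_sum => s _.
apply: smooth_atM; first exact: smooth_at_cst.
by apply: smooth_at_prod => i; exact: sB.
Qed.

(* The product is the (i, j) entry of [invmx (B q)] only where [B q] is
   invertible, which is the case near [p]. *)
Lemma smooth_at_invmx p m (B : M -> 'M[R]_m) i j : B p \in unitmx ->
  (forall i j, smooth_at A (fun q => B q i j) p) ->
  smooth_at A (fun q => (\det (B q))^-1 * \adj (B q) i j) p.
Proof.
rewrite unitmxE unitfE => Bp sB; apply: smooth_atM.
  by apply: smooth_atV => //; exact: smooth_at_det.
rewrite (_ : (fun q => _) = fun q => (-1) ^+ (j + i) * \det (row' j (col' i (B q)))).
  apply: smooth_atM; first exact: smooth_at_cst.
  apply: smooth_at_det => i' j'.
  rewrite (_ : (fun q => _) = fun q => B q (lift j i') (lift i j')) //.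
  by apply/funext => q; rewrite !mxE.
by apply/funext => q; rewrite mxE.
Qed.

Lemma smooth_at_coord p i : smooth_at A (fun q => chart_at A p q ord0 i) p.
Proof.
rewrite /smooth_at; apply: infdiff_eq (infdiff_coord i _).
by apply: filterS (chart_near (chart_at_dom p)) => y [_ /= ->].
Qed.

Lemma tangent_act_linear p h (a : R) v w :
  differentiable (h \o chart_inv (chart_at A p) : _ -> R^o) (chart_at A p p) ->
  tangent_act A p (a *: v + w) h = a * tangent_act A p v h + tangent_act A p w h.
Proof. by move=> dh; rewrite /tangent_act !deriveE// linearP. Qed.

Lemma tangent_act_differential p h v :
  differentiable (h \o chart_inv (chart_at A p) : _ -> R^o) (chart_at A p p) ->
  tangent_act A p v h = (v *m (differential A h p)^T) ord0 ord0.
Proof.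
move=> dh; rewrite /tangent_act deriveE// {1}(row_sum_delta v) linear_sum mxE.
apply: eq_bigr => i _; rewrite linearZ !mxE/=; congr (_ * _).
by rewrite /tangent_act deriveE.
Qed.

Lemma smooth_fieldD p Y Z : smooth_field_at A Y p -> smooth_field_at A Z p ->
  smooth_field_at A (fun q => Y q + Z q) p.
Proof.
move=> sY sZ h sh; apply: smooth_at_near (smooth_atD (sY h sh) (sZ h sh)).
apply: filterS (smooth_at_near_diff sh) => y [_ _ _ dh].
by rewrite /field_act -[Y _ in RHS]scale1r tangent_act_linear// mul1r.
Qed.

Lemma smooth_fieldZ p h Y : smooth_at A h p -> smooth_field_at A Y p ->
  smooth_field_at A (fun q => h q *: Y q) p.
Proof.
move=> sh sY k sk; apply: smooth_at_near (smooth_atM sh (sY k sk)).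
apply: filterS (smooth_at_near_diff sk) => y [_ _ _ dk].
rewrite /field_act -[_ *: _ in RHS]addr0 tangent_act_linear//.
by rewrite [X in _ + X]/tangent_act derive0 addr0.
Qed.

Lemma tangent_act_const_field p v w h : smooth_at A h p ->
  tangent_act A p v (field_act A (const_field A p w) h) =
  'D_v ('D_w (h \o chart_inv (chart_at A p) : _ -> R^o)) (chart_at A p p).
Proof.
by move=> sh; apply: near_eq_derive; exact: const_field_act_near.
Qed.

Lemma const_field_act_comm p v w h : smooth_at A h p ->
  tangent_act A p v (field_act A (const_field A p w) h) =
  tangent_act A p w (field_act A (const_field A p v) h).
Proof.
move=> sh; rewrite (tangent_act_const_field v w sh) (tangent_act_const_field w v sh).
have dD u := nbhs_singleton (infdiff_near_differentiable (infdiff_derive u sh)).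
by apply: derive_comm; [exact: infdiff_near_differentiable|exact: dD|exact: dD].
Qed.

Lemma bracket_const_field p v w :
  bracket A (const_field A p v) (const_field A p w) p = 0.
Proof.
apply/rowP => i; rewrite !mxE !const_field_id.
by rewrite (const_field_act_comm _ _ (smooth_at_coord p i)) subrr.
Qed.

(** The frame matrix [J] times the matrix [K] of differentials of the coordinates at [p], both read
    in the chart at [q], has entries [E_i(x^j)], hence is the identity. *)
Lemma const_frame_unit p :
  \forall y \near chart_at A p p, let q := chart_inv (chart_at A p) y in
  (\matrix_i const_field A p (delta_mx ord0 i) q) \in unitmx.
Proof.
pose C j q := chart_at A p q ord0 j.
pose dC j y := differentiable (C j \o chart_inv (chart_at A p) : _ -> R^o) y /\
  differentiable (C j \o chart_inv (chart_at A (chart_inv (chart_at A p) y)) : _ -> R^o)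
   (chart_at A (chart_inv (chart_at A p) y) (chart_inv (chart_at A p) y)).
have HC : \forall y \near chart_at A p p, forall j, dC j y.
  apply: (@filter_forall _ _ dC (nbhs (chart_at A p p)) _) => j.
  have sj := smooth_at_near_diff (smooth_at_coord p j).
  by apply: filterS sj => y [].
(* An open set is extracted because the identity is later differentiated at [y], so it must hold
   near [y] and not only at [y]. *)
have [U [oU Up UE]] := near_open (chart_near (chart_at_dom p)).
have : \forall y \near chart_at A p p, U y by exact: open_nbhs_nbhs.
apply: filterS2 HC => y H Uy; have ny : nbhs y U by exact: open_nbhs_nbhs.
have [pq yq] := UE y Uy; move: H pq yq; rewrite /dC.
set q := chart_inv _ y => H pq yq; cbv zeta.
set J := \matrix_i _.
pose K : 'M[R]_n := \matrix_(i, j) tangent_act A q (delta_mx ord0 i) (C j).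
have /mulmx1_unit[//] : J *m K = 1%:M.
apply/matrixP => i j; have [dp dq] := H j.
transitivity (tangent_act A q (const_field A p (delta_mx ord0 i) q) (C j)).
  rewrite tangent_act_differential// !mxE; apply: eq_bigr => k _.
  by rewrite !mxE.
rewrite -[LHS]/(field_act A (const_field A p (delta_mx ord0 i)) _ q).
rewrite const_field_actE ?yq//.
rewrite (@near_eq_derive _ _ _ _ (fun y : 'rV[R]_n => y ord0 j : R^o)); last first.
  by apply: filterS ny => z /UE[_ e]; rewrite /C /= e.
by rewrite derive_coord !mxE eqxx eq_sym.
Qed.
End LocalCalculus.

(** * The curvature of the deformed connection *)

Section BilinearForms.
Context (R : realType) (n : nat).
Implicit Types (T : 'M[R]_n) (u v w : 'rV[R]_n).

Lemma bilinDl T u v w : bilin T (u + v) w = bilin T u w + bilin T v w.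
Proof. by rewrite /bilin !mulmxDl mxE. Qed.

Lemma bilinDr T u v w : bilin T u (v + w) = bilin T u v + bilin T u w.
Proof. by rewrite /bilin linearD mulmxDr mxE. Qed.

Lemma bilinZl T (a : R) v w : bilin T (a *: v) w = a * bilin T v w.
Proof. by rewrite /bilin -!scalemxAl mxE. Qed.

Lemma bilinZr T (a : R) v w : bilin T v (a *: w) = a * bilin T v w.
Proof. by rewrite /bilin linearZ -scalemxAr mxE. Qed.

Lemma bilinZform T (a : R) v w : bilin (a *: T) v w = a * bilin T v w.
Proof. by rewrite /bilin -scalemxAr -scalemxAl mxE. Qed.

Lemma bilinBr T u v w : bilin T u (v - w) = bilin T u v - bilin T u w.
Proof. by rewrite -scaleN1r bilinDr bilinZr mulN1r. Qed.

Lemma bilinBl T u v w : bilin T (u - v) w = bilin T u w - bilin T v w.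
Proof. by rewrite -scaleN1r bilinDl bilinZl mulN1r. Qed.

Lemma bilin_tr T u v : bilin T^T u v = bilin T v u.
Proof.
rewrite /bilin; transitivity ((v *m T *m u^T)^T ord0 ord0); last by rewrite mxE.
by rewrite !trmx_mul trmxK mulmxA.
Qed.

Lemma bilin_delta T i j : bilin T (delta_mx ord0 i) (delta_mx ord0 j) = T i j.
Proof. by rewrite /bilin -rowE trmx_delta -colE !mxE. Qed.

End BilinearForms.

(** * Smoothness of the gradient *)

Section Gradient.
Local Open Scope classical_set_scope.
Context (R : realType) (n : nat) (M : topologicalType) (A : smooth_atlas R n M).
Variable g : M -> 'M[R]_n.
Hypothesis g_metric : pseudo_metric A g.

Lemma smooth_at_differentiable p f : smooth_at A f p ->
  differentiable (f \o chart_inv (chart_at A p) : _ -> R^o) (chart_at A p p).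
Proof. by move=> sf; exact: (nbhs_singleton (infdiff_near_differentiable sf)). Qed.

Lemma gradE p f v :
  differentiable (f \o chart_inv (chart_at A p) : _ -> R^o) (chart_at A p p) ->
  tangent_act A p v f = bilin (g p) (grad A g f p) v.
Proof.
move=> df; rewrite tangent_act_differential// /bilin /grad mulmxKV; last first.
  exact: (metric_nondegenerate g_metric).
transitivity ((differential A f p *m v^T)^T ord0 ord0); last by rewrite mxE.
by rewrite trmx_mul trmxK.
Qed.

(* In the frame E_i of coordinate fields at p, with G_ij = g(E_i, E_j), one has
   (grad f) h = sum_ij (E_i f) (G^-1)_ij (E_j h). *)
Lemma grad_smooth p f : smooth_at A f p -> smooth_field_at A (grad A g f) p.
Proof.
move=> sf h sh.
pose E i := const_field A p (delta_mx ord0 i).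
(* The entries of [g q] refer to the chart at [q], which may jump with [q]; the Gram matrix of a
   smooth frame has smooth entries. *)
pose G q : 'M[R]_n := \matrix_(i, j) bilin (g q) (E i q) (E j q).
have sG i j : smooth_at A (fun q => G q i j) p.
  rewrite (_ : (fun q => _) = fun q => bilin (g q) (E i q) (E j q)).
    by apply: (metric_smooth g_metric); exact: const_field_smooth.
  by apply/funext => q; rewrite mxE.
have Gp : G p \in unitmx.
  rewrite (_ : G p = g p); first exact: (metric_nondegenerate g_metric).
  by apply/matrixP => i j; rewrite mxE /E !const_field_id bilin_delta.
have S : smooth_at A (fun q => \sum_i \sum_j
    (field_act A (E i) f q * ((\det (G q))^-1 * \adj (G q) i j))
      * field_act A (E j) h q) p.
  apply: smooth_at_sum => i _; apply: smooth_at_sum => j _.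
  apply: smooth_atM; last by apply: const_field_smooth.
  by apply: smooth_atM; [exact: const_field_smooth|exact: smooth_at_invmx].
apply: smooth_at_near S.
move: (const_frame_unit A p) (smooth_at_near_diff sf) (smooth_at_near_diff sh).
apply: filterS3 => y.
set q := chart_inv _ y; move=> Ju [_ _ _ df] [_ _ _ dh].
set J := \matrix_i _ in Ju.
have gu := metric_nondegenerate g_metric q.
have EJ i : E i q = row i J by rewrite rowK.
have GJ : G q = J *m g q *m J^T.
  apply/matrixP => i j; rewrite mxE !EJ /bilin -!row_mul tr_row.
  by rewrite !mxE; apply: eq_bigr => k _; rewrite !mxE.
have Gu : G q \in unitmx by rewrite GJ !unitmx_mul unitmx_tr Ju gu.
have act i k :
    differentiable (k \o chart_inv (chart_at A q) : _ -> R^o) (chart_at A q q) ->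
    field_act A (E i) k q = (J *m (differential A k q)^T) i ord0.
  move=> dk; rewrite /field_act tangent_act_differential// EJ -row_mul mxE//.
transitivity (((J *m (differential A f q)^T)^T *m invmx (G q)
               *m (J *m (differential A h q)^T)) ord0 ord0).
  rewrite mxE exchange_big; apply: eq_bigr => j _.
  rewrite act// [X in _ = X * _]mxE mulr_suml.
  apply: eq_bigr => i _; rewrite act// /invmx Gu; congr (_ * _ * _).
    by rewrite !mxE.
  by rewrite [RHS]mxE.
rewrite /field_act tangent_act_differential// /grad trmx_mul trmxK.
(* This inverts [G q = J *m g q *m J^T]. *)
have -> : invmx (g q) = J^T *m invmx (G q) *m J.
  rewrite -[RHS](mulKmx gu) -[LHS]mulmx1; congr (_ *m _).
  rewrite -[RHS]mul1mx -[in RHS](mulVmx Ju) -!mulmxA.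
  rewrite [J *m (g q *m _)]mulmxA [J *m g q *m _]mulmxA -GJ.
  by rewrite (mulmxA (G q)) mulmxV// mul1mx mulVmx// mul1mx.
by rewrite !mulmxA.
Qed.

End Gradient.

Section ConnectionDf.
Context (R : realType) (n : nat) (M : topologicalType) (A : smooth_atlas R n M).
Variables (g : M -> 'M[R]_n) (D : operator R n M) (f : M -> R).
Hypotheses (g_metric : pseudo_metric A g) (D_lc : levi_civita A g D).
Hypothesis f_smooth : smooth A f.
Implicit Types (p q : M) (v w : 'rV[R]_n) (X Y Z : vfield R n M).

Local Notation xi := (grad A g f).
Local Notation Df := (connection_df A g D f).

Let D_conn := lc_connection D_lc.

Lemma df_act q v : tangent_act A q v f = bilin (g q) (xi q) v.
Proof. by apply: gradE => //; exact: smooth_at_differentiable. Qed.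

Lemma bilin_metricC q v w : bilin (g q) v w = bilin (g q) w v.
Proof. by rewrite -bilin_tr (Defs.metric_sym g_metric). Qed.

Lemma grad_smooth_field p : smooth_field_at A xi p.
Proof. exact: grad_smooth. Qed.

(** The function [Y f] equals [g(grad f, Y)] everywhere, so compatibility with the metric
    differentiates it. This is how the Hessian enters the curvature. *)
Lemma df_act_act p v Y : smooth_field_at A Y p ->
  tangent_act A p v (field_act A Y f) =
  bilin (g p) (D p v xi) (Y p) + bilin (g p) (xi p) (D p v Y).
Proof.
move=> sY; rewrite -(lc_metric D_lc (@grad_smooth_field p) sY).
by congr tangent_act; apply/funext => q; rewrite /field_act df_act.
Qed.

Lemma connection_df_act p v Y : smooth_field_at A Y p ->
  Df p v Y = D p v Y + bilin (g p) (xi p) v *: Y p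
    + bilin (g p) (xi p) (Y p) *: v + bilin (g p) v (Y p) *: xi p.
Proof. by move=> sY; rewrite /connection_df !df_act. Qed.

Lemma field_act_smooth p Y : smooth_field_at A Y p -> smooth_at A (field_act A Y f) p.
Proof. by move=> sY; apply: sY. Qed.

Lemma metric_smooth_at p Y Z : smooth_field_at A Y p -> smooth_field_at A Z p ->
  smooth_at A (fun q => bilin (g q) (Y q) (Z q)) p.
Proof. exact: (metric_smooth g_metric). Qed.

Lemma cov_connection_df_smooth p Y Z :
  smooth_field_at A Y p -> smooth_field_at A Z p ->
  smooth_field_at A (cov Df Y Z) p.
Proof.
move=> sY sZ; rewrite /cov /connection_df.
apply: smooth_fieldD; last first.
  by apply: smooth_fieldZ; [exact: metric_smooth_at|exact: grad_smooth_field].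
apply: smooth_fieldD; last by apply: smooth_fieldZ; [exact: field_act_smooth|].
apply: smooth_fieldD; last by apply: smooth_fieldZ; [exact: field_act_smooth|].
exact: (conn_smooth D_conn).
Qed.

(** Only here are the coefficients [df(Y)], [df(Z)] and [g(Y,Z)] differentiated: the corrections of
    the outer deformed connection are pointwise, by [connection_df_act]. *)
Lemma cov_cov_connection_df p v Y Z :
  smooth_field_at A Y p -> smooth_field_at A Z p ->
  D p v (cov Df Y Z) = D p v (cov D Y Z)
    + ((bilin (g p) (D p v xi) (Y p) + bilin (g p) (xi p) (D p v Y)) *: Z p
       + bilin (g p) (xi p) (Y p) *: D p v Z)
    + ((bilin (g p) (D p v xi) (Z p) + bilin (g p) (xi p) (D p v Z)) *: Y p
       + bilin (g p) (xi p) (Z p) *: D p v Y)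
    + ((bilin (g p) (D p v Y) (Z p) + bilin (g p) (Y p) (D p v Z)) *: xi p
       + bilin (g p) (Y p) (Z p) *: D p v xi).
Proof.
move=> sY sZ; rewrite [cov Df Y Z]/cov /connection_df.
have s1 := conn_smooth D_conn sY sZ.
have s2 := smooth_fieldZ (field_act_smooth sY) sZ.
have s3 := smooth_fieldZ (field_act_smooth sZ) sY.
have s4 := smooth_fieldZ (metric_smooth_at sY sZ) (@grad_smooth_field p).
have add := conn_additive D_conn; have leib := conn_leibniz D_conn.
have s12 := smooth_fieldD s1 s2; have s123 := smooth_fieldD s12 s3.
have -> := add _ _ _ s123 s4 v; have -> := add _ _ _ s12 s3 v.
have -> := add _ _ _ s1 s2 v.
have -> := leib _ _ _ (field_act_smooth sY) sZ v.
have -> := leib _ _ _ (field_act_smooth sZ) sY v.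
have -> := leib _ _ _ (metric_smooth_at sY sZ) (@grad_smooth_field p) v.
rewrite !df_act_act// (lc_metric D_lc sY sZ).
by rewrite /field_act !df_act.
Qed.

(** Metric symmetry and absence of torsion cancel every first derivative of [X], [Y] and [Z] in the
    corrections. What remains is tensorial: terms linear in the Hessian and terms quadratic in
    [df]. *)
Lemma curvature_connection_df p X Y Z : smooth_field_at A X p ->
  smooth_field_at A Y p -> smooth_field_at A Z p ->
  let b := bilin (g p) in let x := X p in let y := Y p in let z := Z p in
  let u := xi p in let hx := D p x xi in let hy := D p y xi in
  curvature A Df X Y Z p = curvature A D X Y Z p
    + (b hx y - b hy x) *: z
    + b hx z *: y - b hy z *: x + b y z *: hx - b x z *: hy
    + (b u y * b u z + b u u * b y z) *: x
    - (b u x * b u z + b u u * b x z) *: y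
    + (b u x * b y z - b u y * b x z) *: u.
Proof.
move=> sX sY sZ b x y z u hx hy.
have sYZ := cov_connection_df_smooth sY sZ.
have sXZ := cov_connection_df_smooth sX sZ.
have tors : bracket A X Y p = D p x Y - D p y X.
  by rewrite -(lc_torsion_free D_lc sX sY).
rewrite /curvature {1}[cov Df X _ p]/cov {1}[cov Df Y (cov Df X Z) p]/cov
  {1}[cov Df (bracket _ _ _) _ p]/cov.
rewrite !connection_df_act// !cov_cov_connection_df//.
rewrite [cov Df Y Z p]/cov [cov Df X Z p]/cov !connection_df_act//.
rewrite [cov D X (cov D Y Z) p]/cov [cov D Y (cov D X Z) p]/cov
  [cov D (bracket _ _ _) _ p]/cov.
rewrite -/x -/y -/z -/u -/hx -/hy -/b.
(* The terms of the undeformed curvature are abstracted first, so that [tors] rewrites the bracket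
   only in the corrections. *)
move: (D p x (cov D Y Z)) (D p y (cov D X Z)) (D p (bracket A X Y p) Z) => WXY WYX WB.
rewrite tors.
move: (D p x Y) (D p y X) (D p x Z) (D p y Z) => a a' c d.
have bC v w : b v w = b w v by exact: bilin_metricC.
rewrite /b !(bilinBr, bilinBl, bilinDr, bilinDl, bilinZr, bilinZl) -/b.
rewrite (bC y u) (bC x u) (bC y x).
by clearbody hx hy u; apply/rowP => i; rewrite !mxE; ring.
Qed.

Lemma hess_entry p i j :
  hess A g D f p i j = bilin (g p) (D p (delta_mx ord0 i) xi) (delta_mx ord0 j).
Proof.
rewrite /hess /bilin trmx_delta -colE !mxE; apply: eq_bigr => k _.
by rewrite !mxE.
Qed.

(** For coordinate fields [X(Y f) = Hess(X,Y) + df(D_X Y)]. The left side is symmetric because mixed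
    derivatives commute, and [D_X Y = D_Y X] because the bracket vanishes. *)
Lemma hess_sym p : (hess A g D f p)^T = hess A g D f p.
Proof.
apply/matrixP => i j; rewrite mxE !hess_entry.
set x := delta_mx ord0 i; set y := delta_mx ord0 j.
pose X := const_field A p x; pose Y := const_field A p y.
have sX : smooth_field_at A X p by exact: const_field_smooth.
have sY : smooth_field_at A Y p by exact: const_field_smooth.
have Xp : X p = x by exact: const_field_id.
have Yp : Y p = y by exact: const_field_id.
have Eij := df_act_act x sY; have Eji := df_act_act y sX.
have := lc_torsion_free D_lc sX sY.
rewrite bracket_const_field /cov Xp Yp => /eqP; rewrite subr_eq0 => /eqP tors.
have comm := const_field_act_comm x y (f_smooth p).
rewrite Xp in Eji; rewrite Yp in Eij.
by move: comm; rewrite Eij Eji tors => /addIr.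
Qed.

Lemma sum_delta (F : 'I_n -> R) j :
  \sum_k F k * (delta_mx ord0 j : 'rV[R]_n) ord0 k = F j.
Proof.
rewrite (bigD1 j)//= big1 ?addr0 => [|k kj]; first by rewrite mxE !eqxx mulr1.
by rewrite mxE (negbTE kj) mulr0.
Qed.

(** Tracing over [x], the Hessian terms give [H - n H - H], and [b y z *: hx] gives [Lap g]. The
    coefficient of df (x) df is [n - 1 - 1], and that of [|grad f|^2 g] is [n - 1 + 1]. *)
Lemma ricci_connection_df p :
  ricci A Df p = ricci A D p - n%:R *: hess A g D f p
    + (laplacian A g D f p + n%:R * bilin (g p) (xi p) (xi p)) *: g p
    + (n%:R - 2) *: ((differential A f p)^T *m differential A f p).
Proof.
set H := hess A g D f p; set s := bilin (g p) (xi p) (xi p).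
set C := cov_grad A g D f p; set du := differential A f p.
have gu := metric_nondegenerate g_metric p.
have lapE : laplacian A g D f p = \tr C.
  by rewrite /laplacian /mxtrace_wrt /raise mulmxK.
have uE k : bilin (g p) (xi p) (delta_mx ord0 k) = du ord0 k.
  by rewrite /bilin trmx_delta -colE mulmxKV// mxE.
apply/matrixP => i j; rewrite mxE.
have term k : curvature_at A Df p (delta_mx ord0 k) (delta_mx ord0 i)
     (delta_mx ord0 j) ord0 k =
   curvature_at A D p (delta_mx ord0 k) (delta_mx ord0 i) (delta_mx ord0 j) ord0 k
   + (H k i - H i k) * (delta_mx ord0 j : 'rV[R]_n) ord0 k
   + (H k j - (du ord0 k * du ord0 j + s * g p k j))
       * (delta_mx ord0 i : 'rV[R]_n) ord0 k
   + (du ord0 i * du ord0 j + s * g p i j - H i j)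
   + g p i j * C k k - C i k * g p k j
   + (du ord0 k * xi p ord0 k) * g p i j
   - du ord0 i * (xi p ord0 k * g p k j).
  rewrite /curvature_at curvature_connection_df; try exact: const_field_smooth.
  move: (curvature A D _ _ _ p) => r.
  rewrite !const_field_id !uE !bilin_delta -!hess_entry -/H.
  have DC l m : D p (delta_mx ord0 l) xi ord0 m = C l m by rewrite mxE.
  have ekk : (delta_mx ord0 k : 'rV[R]_n) ord0 k = 1 by rewrite mxE !eqxx.
  have dE l : (delta_mx ord0 l : 'rV[R]_n) ord0 k = (k == l)%:R by rewrite mxE eqxx.
  have addE (v w : 'rV[R]_n) : (v + w) ord0 k = v ord0 k + w ord0 k by rewrite mxE.
  have oppE (v : 'rV[R]_n) : (- v) ord0 k = - v ord0 k by rewrite mxE.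
  have scaleE a (v : 'rV[R]_n) : (a *: v) ord0 k = a * v ord0 k by rewrite mxE.
  rewrite !(addE, oppE, scaleE) !DC ekk !dE -/s.
  clearbody C H du s; move: (xi p ord0 k) => a.
  move: ((k == i)%:R : R) ((k == j)%:R : R) => di dj.
  move: (H k i) (H i k) (H k j) (H i j) (C k k) (C i k) => h1 h2 h3 h4 c1 c2.
  by move: (g p i j) (g p k j) (du ord0 i) (du ord0 j) (du ord0 k) => *; ring.
have trE (F : 'rV[R]_n -> 'rV[R]_n) :
    \tr (lin1_mx F) = \sum_k F (delta_mx ord0 k) ord0 k.
  by apply: eq_bigr => k _; rewrite mxE.
have sumC : \sum_k C i k * g p k j = H i j by rewrite /H /hess [RHS]mxE.
have sumu : \sum_k du ord0 k * xi p ord0 k = s.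
  rewrite /s /bilin {1}/grad mulmxKV// [RHS]mxE.
  by apply: eq_bigr => k _; rewrite [X in _ = _ * X]mxE.
have sumxi : \sum_k xi p ord0 k * g p k j = du ord0 j.
  by rewrite -uE /bilin trmx_delta -colE !mxE.
rewrite trE (eq_bigr _ (fun k _ => term k)).
rewrite !big_split/= !sumrN !sum_delta.
rewrite !sumr_const card_ord sumC -mulr_sumr.
have -> : \sum_k (du ord0 k * xi p ord0 k * g p i j) = s * g p i j.
  by rewrite -mulr_suml sumu.
have -> : \sum_k (du ord0 i * (xi p ord0 k * g p k j)) = du ord0 i * du ord0 j.
  by rewrite -mulr_sumr sumxi.
(* Symmetry removes the trace of the term [(b hx y - b hy x) *: z]. *)
have -> : H j i = H i j by have /matrixP/(_ i j) := hess_sym p; rewrite mxE.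
have addE (v w : 'M[R]_n) : (v + w) i j = v i j + w i j by rewrite mxE.
have oppE (v : 'M[R]_n) : (- v) i j = - v i j by rewrite mxE.
have scaleE a (v : 'M[R]_n) : (a *: v) i j = a * v i j by rewrite mxE.
have dudu : (du^T *m du) i j = du ord0 i * du ord0 j.
  by rewrite mxE big_ord1 mxE.
have ricE : ricci A D p i j = \sum_k curvature_at A D p (delta_mx ord0 k)
    (delta_mx ord0 i) (delta_mx ord0 j) ord0 k by rewrite mxE trE.
rewrite !(addE, oppE, scaleE) dudu lapE ricE -[\sum_k C k k]/(\tr C).
rewrite -(mulr_natl (du _ _ * _)) -(mulr_natl (s * _)) -(mulr_natl (H i j)).
move: (\sum_k _) (\tr C) (H i j) (g p i j) (du ord0 i) (du ord0 j) (n%:R : R) => *.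
by clearbody s; ring.
Qed.

End ConnectionDf.

(** * Norms of (0,2)-tensors *)

Section TensorNorm.
Context (R : realType) (n : nat) (G : 'M[R]_n) (u : 'rV[R]_n).
Hypotheses (G_sym : G^T = G) (G_unit : G \in unitmx).
Implicit Types (B : 'M[R]_n) (a b c : R).

Local Notation W := (u^T *m u).
Local Notation x := (u *m invmx G).

Lemma invmx_sym : (invmx G)^T = invmx G.
Proof. by rewrite trmx_inv G_sym. Qed.

Lemma mxtrace_wrtD B B' : mxtrace_wrt G (B + B') = mxtrace_wrt G B + mxtrace_wrt G B'.
Proof. by rewrite /mxtrace_wrt /raise mulmxDl mxtraceD. Qed.

Lemma mxtrace_wrtZ a B : mxtrace_wrt G (a *: B) = a * mxtrace_wrt G B.
Proof. by rewrite /mxtrace_wrt /raise -scalemxAl mxtraceZ. Qed.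

Lemma trace_entry (B : 'M[R]_1) : \tr B = B ord0 ord0.
Proof. by rewrite /mxtrace big_ord1. Qed.

(** For [u = df] the vector [x] is the gradient, so cyclicity of the trace turns the inner product
    of [B] with df (x) df into [B(grad f, grad f)]. *)
Lemma bilin_raise B : bilin B x x = \tr (invmx G *m B *m invmx G *m W).
Proof.
rewrite !mulmxA mxtrace_mulC /bilin trmx_mul invmx_sym -trace_entry.
by rewrite !mulmxA.
Qed.

Lemma mxtrace_wrt_rank1 : mxtrace_wrt G W = bilin G x x.
Proof.
rewrite bilin_raise mulVmx// mul1mx /mxtrace_wrt /raise.
by rewrite mxtrace_mulC.
Qed.

Lemma bilin_rank1 : bilin W x x = bilin G x x ^+ 2.
Proof.
have E : bilin G x x = (x *m u^T) ord0 ord0.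
  by rewrite /bilin mulmxKV// trmx_mul invmx_sym mulmxA.
rewrite E /bilin mulmxA -mulmxA -[u *m x^T]trmxK trmx_mul trmxK.
by rewrite mxE big_ord1 [X in _ * X]mxE expr2.
Qed.

Lemma sqnormDZ B B' a : sqnorm G (B + a *: B') =
  sqnorm G B + 2 * a * \tr (invmx G *m B *m invmx G *m B'^T) + a ^+ 2 * sqnorm G B'.
Proof.
(* Transposition and cyclicity exchange the two cross terms, because [invmx G] is symmetric. *)
have C : \tr (invmx G *m B' *m invmx G *m B^T) = \tr (invmx G *m B *m invmx G *m B'^T).
  rewrite -mxtrace_tr !trmx_mul trmxK !invmx_sym -[in LHS]mxtrace_mulC.
  by rewrite [LHS]mxtrace_mulC !mulmxA mxtrace_mulC !mulmxA.
have TE : (B + a *: B')^T = B^T + a *: B'^T by rewrite linearD linearZ.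
rewrite /sqnorm TE !(mulmxDl, mulmxDr) -!(scalemxAl, scalemxAr) !mxtraceD.
by rewrite !mxtraceZ C; ring.
Qed.

Lemma sqnormZ B a : sqnorm G (a *: B) = a ^+ 2 * sqnorm G B.
Proof.
rewrite -[a *: B]add0r sqnormDZ /sqnorm !(mulmx0, mul0mx, trmx0) mxtrace0.
by rewrite mulr0 !add0r.
Qed.

Lemma sqnormD_rank1 B a : sqnorm G (B + a *: W) =
  sqnorm G B + 2 * a * bilin B x x + a ^+ 2 * bilin G x x ^+ 2.
Proof.
have WT : W^T = W by rewrite trmx_mul trmxK.
by rewrite sqnormDZ WT -bilin_raise [sqnorm G W]/sqnorm WT -bilin_raise bilin_rank1.
Qed.

(* The trace-free part of a tensor is orthogonal to [G], and [|G|^2 = n > 0]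
   whatever the signature: hence the inequality for indefinite [G]. *)
Lemma sqnormD_metric_ge B c : (0 < n)%N ->
  sqnorm G B - mxtrace_wrt G B ^+ 2 / n%:R <= sqnorm G (B + c *: G).
Proof.
move=> n0; have N0 : 0 < n%:R :> R by rewrite ltr0n.
have trG : \tr (invmx G *m B *m invmx G *m G^T) = mxtrace_wrt G B.
  by rewrite G_sym mulmxKV// mxtrace_mulC.
have GG : sqnorm G G = n%:R.
  by rewrite /sqnorm G_sym mulVmx// mul1mx mulVmx// mxtrace1.
rewrite sqnormDZ trG GG; set t := mxtrace_wrt G B; set s := sqnorm G B.
rewrite -subr_ge0.
rewrite (_ : _ - _ = n%:R * (c + t / n%:R) ^+ 2); last first.
  by field; rewrite gt_eqF.
by apply: mulr_ge0; [exact: ltW|exact: sqr_ge0].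
Qed.

End TensorNorm.

(** * The soliton equation and the two inequalities *)

Lemma soliton_ricci (R : realType) (n : nat) (M : topologicalType)
    (A : smooth_atlas R n M) (g : M -> 'M[R]_n) (D : operator R n M)
    (f lambda : M -> R) (p : M) :
  pseudo_metric A g -> levi_civita A g D -> smooth A f ->
  gradient_almost_soliton A g D (Q_df A g D f) f lambda ->
  exists c, ricci A D p = (n%:R - 1) *: hess A g D f p
    - (n%:R - 2) *: ((differential A f p)^T *m differential A f p) + c *: g p.
Proof.
move=> g_metric D_lc f_smooth /(_ p); rewrite /Q_df ricci_connection_df//.
have gu := metric_nondegenerate g_metric p.
(* Multiplying by [g p] lowers an index and turns the equation of endomorphisms into one of bilinear
   forms. *)
move=> /(congr1 (mulmx^~ (g p))); rewrite mulmxDl mulmxKV// mul_scalar_mx.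
rewrite -/(hess A g D f p); set c := _ + _ * bilin _ _ _ => sol.
(* Here [c] is [Lap f + n |grad f|^2], the coefficient of [g] in the deformed Ricci tensor. *)
exists (lambda p - c); move: sol.
move: (lambda p) (hess A g D f p) (ricci A D p) (g p) (_^T *m _) => l H Ric G W.
move=> /matrixP sol; apply/matrixP => i j; move: (sol i j); rewrite !mxE.
by move: (H i j) (Ric i j) (G i j) (W i j) => *; lra.
Qed.

Theorem proposition3p13 (R : realType) (n : nat) (n_gt0 : (0 < n)%N)
    (M : topologicalType)
    (M_hausdorff : hausdorff_space M) (M_countable : @second_countable M)
    (A : smooth_atlas R n M)
    (g : M -> 'M[R]_n) (g_metric : pseudo_metric A g)
    (nabla : operator R n M) (nabla_lc : levi_civita A g nabla)
    (f : M -> R) (f_smooth : smooth A f)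
    (lambda : M -> R) (lambda_smooth : smooth A lambda)
    (soliton : gradient_almost_soliton A g nabla (Q_df A g nabla f) f lambda)
    (p : M) :
  let N : R := n%:R in
  let xi := grad A g f p in
  let xi2 := bilin (g p) xi xi in
  let H := hess A g nabla f p in
  let Lap := laplacian A g nabla f p in
  let Ric := ricci A nabla p in
  let S := scal A g nabla p in
  (N - 1) ^+ 2 * sqnorm (g p) H
    + (N - 1) * (N - 2) ^+ 2 / N * xi2 ^+ 2
    - (N - 1) ^+ 2 / N * Lap ^+ 2
    + 2 * (N - 1) * (N - 2) / N * xi2 * Lap
    - 2 * (N - 1) * (N - 2) * bilin H xi xi
    <= sqnorm (g p) Ric
  /\
  sqnorm (g p) Ric
    <= (N - 1) ^+ 2 * sqnorm (g p) H
       - (N - 1) * (N - 2) ^+ 2 / N * xi2 ^+ 2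
       + N^-1 * S ^+ 2
       + 2 * (N - 2) / N * xi2 * S
       - 2 * (N - 2) * bilin Ric xi xi.
Proof.
move=> N xi xi2 H Lap Ric S.
have [c RicE] := soliton_ricci p g_metric nabla_lc f_smooth soliton.
have gs := Defs.metric_sym g_metric p; have gu := metric_nondegenerate g_metric p.
have N0 : N != 0 by rewrite /N pnatr_eq0 -lt0n.
set u := differential A f p in RicE.
have sqW B a := sqnormD_rank1 u gs gu B a.
have trW B a : mxtrace_wrt (g p) (B + a *: (u^T *m u)) = mxtrace_wrt (g p) B + a * xi2.
  by rewrite mxtrace_wrtD mxtrace_wrtZ mxtrace_wrt_rank1.
rewrite -/Ric -/H -/N in RicE; split.
  have := sqnormD_metric_ge gs gu ((N - 1) *: H - (N - 2) *: (u^T *m u)) c n_gt0.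
  rewrite -RicE -scaleNr sqW trW sqnormZ// mxtrace_wrtZ bilinZform.
  (* The stated lower bound is exactly [|B|^2 - (tr B)^2 / n], expanded. *)
  apply: le_trans; rewrite le_eqVlt; apply/orP; left; apply/eqP.
  by rewrite -/N -/xi -/xi2 -/Lap; field.
have HE : (N - 1) *: H = Ric + (N - 2) *: (u^T *m u) + (- c) *: g p.
  by rewrite RicE scaleNr addrAC addrK subrK.
have := sqnormD_metric_ge gs gu (Ric + (N - 2) *: (u^T *m u)) (- c) n_gt0.
rewrite -HE sqW trW sqnormZ// -/N -/xi -/xi2 -/S.
(* In this case [|Ric|^2] sits inside [|B|^2] on the smaller side; once both inequalities read
   [0 <= _], their right-hand sides are equal. *)
rewrite -subr_ge0 -[X in _ -> is_true X]subr_ge0.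
by move=> /le_trans; apply; rewrite le_eqVlt; apply/orP; left; apply/eqP; field.
Qed.
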